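(* Let $f^{\mathrm{num}}$ be a continuous numerical flux for the one-dimensional compressible Euler equations that is EC, KEP and PEP, and for each $p>0$ write its density flux at pairs of states with $p_+=p_-=p$ as $f^{\mathrm{num}}_\rho=\{\{\rho\}\}_{\log}\{\{v\}\}+\chi_p(\rho_\pm,v_\pm)$. Then the density flux $f^{\mathrm{num}}_\rho$ depends on the pressures $p_\pm$ (as a function of general pairs of states) unless the perturbation vanishes, i.e. $\chi_p=0$ for all $p$. Consequently, the numerical flux $$f^{\mathrm{num}}_{\rho}=\{\{\rho\}\}_{\log}\{\{v\}\},$$ $$f^{\mathrm{num}}_{\rho v}=\{\{\rho\}\}_{\log}\{\{v\}\}^2+\{\{p\}\},$$ $$f^{\mathrm{num}}_{\rho e}=\tfrac12\{\{\rho\}\}_{\log}\{\{v\}\}((v\cdot v))+\tfrac{1}{\gamma-1}\{\{\rho\}\}_{\log}\{\{\rho/p\}\}_{\log}^{-1}\{\{v\}\}+((p\cdot v))$$ is, for general velocities $v_\pm$, the unique continuous numerical flux that is EC, KEP, PEP and has a density flux that does not depend on the pressure.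
   Context: The 1D compressible Euler equations are $\partial_t u+\partial_x f(u)=0$, $u=(\rho,\rho v,\rho e)$, $f(u)=(\rho v,\rho v^2+p,(\rho e+p)v)$, $p=(\gamma-1)(\rho e-\frac12\rho v^2)$, with $\gamma>1$. States are those with $\rho>0$, $p>0$, $v\in\mathbb{R}$, described by $(\rho,v,p)$. A numerical flux $f^{\mathrm{num}}(u_+,u_-)=(f^{\mathrm{num}}_{\rho},f^{\mathrm{num}}_{\rho v},f^{\mathrm{num}}_{\rho e})$ is a function of two states that is consistent: $f^{\mathrm{num}}(u,u)=f(u)$. Notation: $[[a]]=a_+-a_-$, $\{\{a\}\}=(a_++a_-)/2$, $\{\{a\}\}_{\log}=[[a]]/[[\log a]]$ for positive $a_\pm$ (extended continuously by $\{\{a\}\}_{\log}=a$ if $a_+=a_-=a$), $((a\cdot b))=(a_+b_-+a_-b_+)/2$. The entropy is $U=-\rho s/(\gamma-1)$, $s=\log(p/\rho^\gamma)$, with entropy variables $w=\left(\frac{\gamma}{\gamma-1}-\frac{\log(p/\rho^\gamma)}{\gamma-1}-\frac{\rho v^2}{2p},\frac{\rho v}{p},-\frac{\rho}{p}\right)$ and flux potential $\psi=\rho v$. EC (entropy-conservative): $[[w]]\cdot f^{\mathrm{num}}-[[\psi]]=0$ for all pairs of states. KEP (kinetic-energy-preserving): $f^{\mathrm{num}}_{\rho v}=\{\{v\}\}f^{\mathrm{num}}_\rho+\{\{p\}\}$ for all pairs of states. PEP (pressure-equilibrium-preserving): whenever $v_+=v_-=v$ and $p_+=p_-=p$, one has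 $f^{\mathrm{num}}_{\rho v}=v f^{\mathrm{num}}_\rho+\mathrm{const}(p,v)$ and $f^{\mathrm{num}}_{\rho e}=\frac12v^2f^{\mathrm{num}}_\rho+\mathrm{const}(p,v)$, where each $\mathrm{const}(p,v)$ denotes a (possibly different) quantity depending only on $p$ and $v$, not on $\rho_\pm$. *)

(* Defs.v *)
From HB Require Import structures.
From mathcomp Require Import all_boot all_order all_algebra.
From mathcomp Require Import all_classical all_reals all_analysis.

Set Implicit Arguments.
Unset Strict Implicit.
Unset Printing Implicit Defensive.

Import Order.TTheory GRing.Theory Num.Theory.
Import numFieldNormedType.Exports.

Local Open Scope classical_set_scope.
Local Open Scope ring_scope.

(* Three kinds of triples occur, all of type R * R * R: primitive states
   (rho, v, p), conserved variables (rho, rho v, rho e), and fluxes. Two-point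
   quantities take the "+" argument first. *)

Definition cmp1 (R : realType) (x : R * R * R) : R := x.1.1.
Definition cmp2 (R : realType) (x : R * R * R) : R := x.1.2.
Definition cmp3 (R : realType) (x : R * R * R) : R := x.2.

Definition dot3 (R : realType) (x y : R * R * R) : R :=
  cmp1 x * cmp1 y + cmp2 x * cmp2 y + cmp3 x * cmp3 y.

(* The set of primitive states (rho, v, p). *)
Definition states (R : realType) : set (R * R * R) :=
  [set x | 0 < cmp1 x /\ 0 < cmp3 x].
Arguments states : clear implicits.

Definition mean (R : realType) (ap am : R) : R := (ap + am) / 2.

Definition log_mean (R : realType) (ap am : R) : R :=
  if ap == am then ap else (ap - am) / (ln ap - ln am).

(* ((a . b)) *)
Definition prod_mean (R : realType) (ap am bp bm : R) : R :=
  (ap * bm + am * bp) / 2.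

(* (rho, v, p) |-> (rho, rho v, rho e), the energy being obtained by inverting
   p = (gamma - 1) (rho e - rho v^2 / 2). *)
Definition conserved (R : realType) (gamma : R) (x : R * R * R) : R * R * R :=
  let rho := cmp1 x in let v := cmp2 x in let p := cmp3 x in
  (rho, rho * v, p / (gamma - 1) + rho * v ^+ 2 / 2).

(* The Euler flux as a function of the conserved variables. *)
Definition euler_flux (R : realType) (gamma : R) (u : R * R * R) : R * R * R :=
  let rho := cmp1 u in let v := cmp2 u / cmp1 u in let rhoe := cmp3 u in
  let p := (gamma - 1) * (rhoe - rho * v ^+ 2 / 2) in
  (rho * v, rho * v ^+ 2 + p, (rhoe + p) * v).

Definition entropy_vars (R : realType) (gamma : R) (x : R * R * R) :
    R * R * R :=
  let rho := cmp1 x in let v := cmp2 x in let p := cmp3 x in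
  (gamma / (gamma - 1) - ln (p / rho `^ gamma) / (gamma - 1)
     - rho * v ^+ 2 / (2 * p),
   rho * v / p,
   - (rho / p)).

Definition flux_potential (R : realType) (x : R * R * R) : R :=
  cmp1 x * cmp2 x.

(* A two-point flux is a function of two primitive states; only its values on
   [states R] are meaningful. *)
Definition consistent (R : realType) (gamma : R)
    (f : R * R * R -> R * R * R -> R * R * R) : Prop :=
  forall x, states R x -> f x x = euler_flux gamma (conserved gamma x).

Definition flux_continuous (R : realType)
    (f : R * R * R -> R * R * R -> R * R * R) : Prop :=
  {within states R `*` states R, continuous (fun z => f z.1 z.2)}.

Definition EC (R : realType) (gamma : R)
    (f : R * R * R -> R * R * R -> R * R * R) : Prop :=
  forall xp xm, states R xp -> states R xm ->
    dot3 (entropy_vars gamma xp - entropy_vars gamma xm) (f xp xm)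
      - (flux_potential xp - flux_potential xm) = 0.

Definition KEP (R : realType)
    (f : R * R * R -> R * R * R -> R * R * R) : Prop :=
  forall xp xm, states R xp -> states R xm ->
    cmp2 (f xp xm) =
      mean (cmp2 xp) (cmp2 xm) * cmp1 (f xp xm) + mean (cmp3 xp) (cmp3 xm).

Definition PEP (R : realType)
    (f : R * R * R -> R * R * R -> R * R * R) : Prop :=
  exists c d : R -> R -> R, forall rhop rhom v p : R,
    0 < rhop -> 0 < rhom -> 0 < p ->
    let F := f (rhop, v, p) (rhom, v, p) in
    cmp2 F = v * cmp1 F + c p v /\
    cmp3 F = v ^+ 2 / 2 * cmp1 F + d p v.

Definition density_flux_depends_on_pressure (R : realType)
    (f : R * R * R -> R * R * R -> R * R * R) : Prop :=
  exists rhop rhom vp vm pp pm qp qm : R,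
    [/\ 0 < rhop /\ 0 < rhom, 0 < pp /\ 0 < pm, 0 < qp /\ 0 < qm &
        cmp1 (f (rhop, vp, pp) (rhom, vm, pm)) <>
        cmp1 (f (rhop, vp, qp) (rhom, vm, qm))].

(* chi_p, defined by f_rho = {{rho}}_log {{v}} + chi_p when p_+ = p_- = p. *)
Definition density_perturbation (R : realType)
    (f : R * R * R -> R * R * R -> R * R * R) (p rhop rhom vp vm : R) : R :=
  cmp1 (f (rhop, vp, p) (rhom, vm, p)) - log_mean rhop rhom * mean vp vm.

Definition EC_KEP_PEP_flux (R : realType) (gamma : R)
    (xp xm : R * R * R) : R * R * R :=
  let rhop := cmp1 xp in let vp := cmp2 xp in let pp := cmp3 xp in
  let rhom := cmp1 xm in let vm := cmp2 xm in let pm := cmp3 xm in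
  (log_mean rhop rhom * mean vp vm,
   log_mean rhop rhom * mean vp vm ^+ 2 + mean pp pm,
   1 / 2 * log_mean rhop rhom * mean vp vm * prod_mean vp vm vp vm
     + 1 / (gamma - 1) * log_mean rhop rhom
         * (log_mean (rhop / pp) (rhom / pm))^-1 * mean vp vm
     + prod_mean pp pm vp vm).

(* A continuous (consistent) numerical flux that is EC, KEP and PEP. *)
Definition continuous_EC_KEP_PEP (R : realType) (gamma : R)
    (f : R * R * R -> R * R * R -> R * R * R) : Prop :=
  [/\ consistent gamma f, flux_continuous f, EC gamma f, KEP f & PEP f].

(* Main.v *)
Require Import Defs.
From HB Require Import structures.
From mathcomp Require Import all_boot all_order all_algebra.
From mathcomp Require Import all_classical all_reals all_analysis.
From mathcomp Require Import ring lra.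

(** Put beta = rho / p. In the EC identity, with the momentum flux replaced by
    its KEP expression, the energy flux is multiplied by - [[beta]] and the
    density flux by [[w_1]] + {{v}} [[w_2]].

    On pairs with [[beta]] = 0 the energy flux drops out. When p = rho on both
    sides, so that beta = 1, the factor of the density flux is [[log rho]], and
    the density flux is therefore determined as soon as rho_+ <> rho_-. If it
    does not depend on the pressure, this determines it for all pressures, and
    continuity covers rho_+ = rho_-. The momentum flux follows by KEP. The
    energy flux follows from EC where [[beta]] <> 0, and, by continuity in
    rho_+, also where [[beta]] = 0.

    Instead of solving these equations, [density_eq] and [flux_eq] compare two
    fluxes with all the properties; their difference satisfies a homogeneous
    linear equation, [EC_KEP_sub], in which the flux potential has cancelled.
    They are applied to an arbitrary flux and the explicit one; the equality of
    the density fluxes is the vanishing of chi_p. What remains is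
    to verify the explicit flux: EC rests on [log_mean_ln] for rho and beta,
    PEP on the homogeneity [log_meanZ], and continuity on [cvg_log_mean]. *)

Set Implicit Arguments.
Unset Strict Implicit.
Unset Printing Implicit Defensive.

Import Order.TTheory GRing.Theory Num.Theory.
Import numFieldNormedType.Exports.

Local Open Scope classical_set_scope.
Local Open Scope ring_scope.

(** * The logarithmic mean *)

Lemma ln_sub_neq0 (R : realType) (a b : R) :
  0 < a -> 0 < b -> a != b -> ln a - ln b != 0.
Proof.
by move=> a0 b0; apply: contra_neq => /subr0_eq; apply: ln_inj; rewrite posrE.
Qed.

Lemma log_meanC (R : realType) (a b : R) : log_mean a b = log_mean b a.
Proof.
rewrite /log_mean eq_sym; case: eqVneq => [->//|_].
by rewrite -(opprB b a) -(opprB (ln b)) invrN mulrNN.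
Qed.

(** The form in which the logarithmic mean enters the entropy balance; unlike
    the quotient that defines it, it needs no case distinction. *)
Lemma log_mean_ln (R : realType) (a b : R) : 0 < a -> 0 < b ->
  log_mean a b * (ln a - ln b) = a - b.
Proof.
move=> a0 b0; rewrite /log_mean; case: eqVneq => [->|ab].
  by rewrite !subrr mulr0.
by rewrite divfK// ln_sub_neq0.
Qed.

Lemma log_meanZ (R : realType) (k a b : R) : 0 < k -> 0 < a -> 0 < b ->
  log_mean (a * k) (b * k) = log_mean a b * k.
Proof.
move=> k0 a0 b0; rewrite /log_mean (inj_eq (mulIf (lt0r_neq0 k0))).
case: eqVneq => // ab; have := ln_sub_neq0 a0 b0 ab.
rewrite !lnM ?posrE// => lnab; field.
by apply: contra_neq lnab => ?; lra.
Qed.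

Lemma ln_sub_le (R : realType) (a b : R) : 0 < a -> 0 < b ->
  ln a - ln b <= (a - b) / b.
Proof.
move=> a0 b0; rewrite -ln_div ?posrE//.
have -> : a / b = 1 + (a - b) / b by field; rewrite gt_eqF.
by apply: le_ln1Dx; rewrite mulrBl divff ?gt_eqF// ltrBrDl subrr divr_gt0.
Qed.

(** The tangent inequality [ln_sub_le], used in both directions, gives
    (a - b) / a <= ln a - ln b <= (a - b) / b. *)
Lemma log_mean_between (R : realType) (a b : R) : 0 < b -> b <= a ->
  b <= log_mean a b <= a.
Proof.
move=> b0; rewrite le_eqVlt => /predU1P[->|ba].
  by rewrite /log_mean eqxx lexx.
have a0 : 0 < a by exact: lt_trans ba.
have ln0 : 0 < ln a - ln b by rewrite subr_gt0 ltr_ln ?posrE.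
rewrite /log_mean gt_eqF// ler_pdivlMr// ler_pdivrMr//; apply/andP; split.
  by have := ln_sub_le a0 b0; rewrite ler_pdivlMr// mulrC.
have := ln_sub_le b0 a0; rewrite ler_pdivlMr//; lra.
Qed.

Lemma log_mean_gt0 (R : realType) (a b : R) : 0 < a -> 0 < b ->
  0 < log_mean a b.
Proof.
move=> a0 b0; have [ba|/ltW ab] := leP b a.
  by case/andP: (log_mean_between b0 ba) => /(lt_le_trans b0).
by rewrite log_meanC; case/andP: (log_mean_between a0 ab) => /(lt_le_trans a0).
Qed.

(** Betweenness restated without comparing a and b, with bounds that are
    visibly continuous: these squeeze the logarithmic mean near the diagonal. *)
Lemma log_mean_dist (R : realType) (c a b : R) : 0 < a -> 0 < b ->
  c - (`|a - c| + `|b - c|) <= log_mean a b <= c + (`|a - c| + `|b - c|).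
Proof.
move=> a0 b0.
have := ler_norm (a - c); have := ler_norm (c - a).
have := ler_norm (b - c); have := ler_norm (c - b).
rewrite (distrC c a) (distrC c b).
have [ba|/ltW ab] := leP b a.
  by case/andP: (log_mean_between b0 ba); lra.
by rewrite log_meanC; case/andP: (log_mean_between a0 ab); lra.
Qed.

(** Off the diagonal the mean is locally the quotient of differences; on the
    diagonal it is squeezed by [log_mean_dist]. *)
Lemma cvg_log_mean (R : realType) (T : Type) (F : set_system T)
    {FF : Filter F} (f g : T -> R) (a b : R) :
  0 < a -> 0 < b -> f t @[t --> F] --> a -> g t @[t --> F] --> b ->
  log_mean (f t) (g t) @[t --> F] --> log_mean a b.
Proof.
move=> a0 b0 fa gb.
have f0 : \forall t \near F, 0 < f t by exact: (cvgr_gt _ fa).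
have g0 : \forall t \near F, 0 < g t by exact: (cvgr_gt _ gb).
have [ab|ab] := eqVneq a b.
  rewrite -{}ab in gb *; rewrite /log_mean eqxx.
  have dist0 : `|f t - a| + `|g t - a| @[t --> F] --> 0.
    have -> : 0 = `|a - a| + `|a - a| :> R by rewrite subrr normr0 addr0.
    by apply: cvgD; apply: cvg_norm; apply: cvgB => //; exact: cvg_cst.
  apply: (squeeze_cvgr (f := fun t => a - (`|f t - a| + `|g t - a|))
                       (h := fun t => a + (`|f t - a| + `|g t - a|))).
  - by near=> t; apply: log_mean_dist; near: t.
  - by rewrite -[X in _ --> X](subr0 a); apply: cvgB => //; exact: cvg_cst.
  - by rewrite -[X in _ --> X](addr0 a); apply: cvgD => //; exact: cvg_cst.
rewrite {2}/log_mean (negbTE ab).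
have fg : (f t - g t) @[t --> F] --> a - b by exact: cvgB.
have fg0 : \forall t \near F, f t - g t != 0.
  by apply: (cvgr_neq0 _ fg); rewrite subr_eq0.
apply: cvg_trans (_ : (f t - g t) / (ln (f t) - ln (g t)) @[t --> F] --> _).
  apply: near_eq_cvg; near=> t; rewrite /log_mean ifF//.
  by apply: negbTE; rewrite -subr_eq0; near: t.
apply: cvgM => //; apply: cvgV; first exact: ln_sub_neq0.
by apply: cvgB; apply: continuous_cvg => //; exact: continuous_ln.
Unshelve. all: by end_near. Qed.

(** * Continuity of two-point fluxes *)

Lemma cmp1_continuous (R : realType) : continuous (@cmp1 R).
Proof. by move=> x; apply: cvg_comp; [exact: cvg_fst|exact: cvg_fst]. Qed.

Lemma cmp2_continuous (R : realType) : continuous (@cmp2 R).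
Proof. by move=> x; apply: cvg_comp; [exact: cvg_fst|exact: cvg_snd]. Qed.

Lemma cmp3_continuous (R : realType) : continuous (@cmp3 R).
Proof. by move=> x; exact: cvg_snd. Qed.

Lemma state_pairs_open (R : realType) : open (states R `*` states R).
Proof.
rewrite openE => z [[r1 p1] [r2 p2]].
have near_gt0 (h : R * R * R -> R) (s : _ -> R * R * R) : continuous h ->
    continuous s -> 0 < h (s z) -> \forall x \near z, 0 < h (s x).
  move=> hc sc; apply: (@cvgr_gt _ _ (nbhs z) _ (fun x => h (s x)) (h (s z))).
  by apply: continuous_cvg; [exact: hc|exact: sc].
have fstc : continuous (@fst (R * R * R) (R * R * R)).
  by move=> x; exact: cvg_fst.
have sndc : continuous (@snd (R * R * R) (R * R * R)).
  by move=> x; exact: cvg_snd.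
near=> x; split; split; near: x; exact: near_gt0 (@cmp1_continuous R) _ _
  || exact: near_gt0 (@cmp3_continuous R) _ _.
Unshelve. all: by end_near. Qed.

Lemma flux_continuousP (R : realType)
    (f : R * R * R -> R * R * R -> R * R * R) :
  flux_continuous f <->
  forall z, states R z.1 -> states R z.2 ->
    {for z, continuous (fun z => f z.1 z.2)}.
Proof.
rewrite /flux_continuous (continuous_open_subspace _ (@state_pairs_open R)).
split=> [fc z z1 z2|fc z]; first by apply: fc; rewrite inE.
by rewrite inE => -[]; exact: fc.
Qed.

(** Moving rho_+ alone leaves both degenerate sets of the uniqueness argument,
    rho_+ = rho_- for the density flux and beta_+ = beta_- for the energy flux;
    hence one limit, along this line, serves for both. *)
Lemma eq_flux_limit (R : realType) (h : R * R * R -> R)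
    (f g : R * R * R -> R * R * R -> R * R * R) (xp xm : R * R * R) :
  continuous h -> flux_continuous f -> flux_continuous g ->
  states R xp -> states R xm ->
  (forall r, 0 < r -> r != cmp1 xp ->
     h (f (r, cmp2 xp, cmp3 xp) xm) = h (g (r, cmp2 xp, cmp3 xp) xm)) ->
  h (f xp xm) = h (g xp xm).
Proof.
move: xp => [[rho v] p] hc fc gc Sp Sm.
rewrite /cmp1 /cmp2 /cmp3/= => fg.
have id : r @[r --> rho^'] --> rho.
  by apply: cvg_trans (@nbhs_dnbhs _ _); exact: cvg_id.
have line : ((r, v, p), xm) @[r --> rho^'] --> ((rho, v, p), xm).
  exact: cvg_pair (cvg_pair (cvg_pair id (cvg_cst v)) (cvg_cst p)) (cvg_cst xm).
have lim k : flux_continuous k ->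
    h (k (r, v, p) xm) @[r --> rho^'] --> h (k (rho, v, p) xm).
  move=> /flux_continuousP kc; apply: continuous_cvg; first exact: hc.
  exact: (cvg_comp _ _ line (kc ((rho, v, p), xm) Sp Sm)).
apply: (cvg_unique (@norm_hausdorff _ R^o)) (lim f fc) _.
apply: cvg_trans (lim g gc).
apply: near_eq_cvg; near=> r; apply/esym/fg; near: r.
  by apply: (cvgr_gt _ id); case: Sp.
exact: nbhs_dnbhs_neq.
Unshelve. all: by end_near. Qed.

(** * Uniqueness *)

Lemma cmp1_entropy_vars (R : realType) (gamma : R) (x : R * R * R) :
  states R x ->
  cmp1 (entropy_vars gamma x) = gamma / (gamma - 1)
    - (ln (cmp3 x) - gamma * ln (cmp1 x)) / (gamma - 1)
    - cmp1 x * cmp2 x ^+ 2 / (2 * cmp3 x).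
Proof.
case=> r0 p0; rewrite {1}/cmp1 /=.
by rewrite ln_div ?posrE ?powR_gt0// ln_powR.
Qed.

(** KEP fixes the momentum flux up to the density flux, so in the difference
    of two EC identities both [[psi]] and {{p}} cancel. *)
Lemma EC_KEP_sub (R : realType) (gamma : R)
    (f g : R * R * R -> R * R * R -> R * R * R) (xp xm : R * R * R) :
  EC gamma f -> KEP f -> EC gamma g -> KEP g ->
  states R xp -> states R xm ->
  let w := entropy_vars gamma xp - entropy_vars gamma xm in
  (cmp1 w + mean (cmp2 xp) (cmp2 xm) * cmp2 w)
    * (cmp1 (f xp xm) - cmp1 (g xp xm))
  + cmp3 w * (cmp3 (f xp xm) - cmp3 (g xp xm)) = 0.
Proof.
move=> fE fK gE gK Sp Sm w.
have := fE _ _ Sp Sm; have := gE _ _ Sp Sm.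
rewrite -/w /dot3 (fK _ _ Sp Sm) (gK _ _ Sp Sm); move: (flux_potential xp - _).
move: (mean _ _) (mean _ _) => v p psi gw fw.
rewrite -[RHS](subrr 0) -{1}fw -gw; ring.
Qed.

(** Pressure independence allows the choice p = rho on both sides, where
    [[w_3]] = 0 and [[w_1]] + {{v}} [[w_2]] = [[log rho]]. *)
Lemma density_eq (R : realType) (gamma : R)
    (f g : R * R * R -> R * R * R -> R * R * R) :
  1 < gamma ->
  continuous_EC_KEP_PEP gamma f -> continuous_EC_KEP_PEP gamma g ->
  ~ density_flux_depends_on_pressure f ->
  ~ density_flux_depends_on_pressure g ->
  forall xp xm, states R xp -> states R xm -> cmp1 (f xp xm) = cmp1 (g xp xm).
Proof.
move=> gamma1 [_ fc fE fK _] [_ gc gE gK _] fN gN.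
have indep (k : R * R * R -> R * R * R -> R * R * R) :
    ~ density_flux_depends_on_pressure k ->
    forall rp rm vp vm pp pm : R, 0 < rp -> 0 < rm -> 0 < pp -> 0 < pm ->
    cmp1 (k (rp, vp, pp) (rm, vm, pm)) = cmp1 (k (rp, vp, rp) (rm, vm, rm)).
  move=> kN rp rm vp vm pp pm rp0 rm0 pp0 pm0; apply: contrapT => neq.
  by apply: kN; exists rp, rm, vp, vm, pp, pm, rp, rm; split.
have neq (rp rm vp vm pp pm : R) :
    0 < rp -> 0 < rm -> 0 < pp -> 0 < pm -> rp != rm ->
    cmp1 (f (rp, vp, pp) (rm, vm, pm)) = cmp1 (g (rp, vp, pp) (rm, vm, pm)).
  move=> rp0 rm0 pp0 pm0 rpm; rewrite (indep f)// (indep g)//.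
  have Sp : states R (rp, vp, rp) by [].
  have Sm : states R (rm, vm, rm) by [].
  have := EC_KEP_sub fE fK gE gK Sp Sm.
  set Df := cmp1 (f _ _); set Dg := cmp1 (g _ _).
  rewrite /= [cmp1 _](_ : _ = cmp1 (entropy_vars gamma (rp, vp, rp))
    - cmp1 (entropy_vars gamma (rm, vm, rm)))// !cmp1_entropy_vars//.
  rewrite /entropy_vars /cmp3 /cmp2 /cmp1/= /mean.
  rewrite !divff ?gt_eqF// subrr mul0r addr0 => /eqP.
  rewrite mulf_eq0 => /orP[|/eqP/subr0_eq//].
  rewrite [X in X == 0](_ : _ = ln rp - ln rm).
    by rewrite (negbTE (ln_sub_neq0 _ _ _)).
  by field; rewrite !gt_eqF//= subr_gt0.
move=> [[rp vp] pp] [[rm vm] pm] Sp Sm.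
have [rp0 pp0] := Sp; have [rm0 pm0] := Sm.
have [rpm|] := eqVneq rp rm; last exact: neq.
apply: eq_flux_limit => //; first exact: cmp1_continuous.
by rewrite /cmp1/= rpm => r r0 rne; exact: neq.
Qed.

(** Once the density fluxes agree, [EC_KEP_sub] leaves - [[beta]] times the
    difference of the energy fluxes. *)
Lemma flux_eq (R : realType) (gamma : R)
    (f g : R * R * R -> R * R * R -> R * R * R) :
  1 < gamma ->
  continuous_EC_KEP_PEP gamma f -> continuous_EC_KEP_PEP gamma g ->
  ~ density_flux_depends_on_pressure f ->
  ~ density_flux_depends_on_pressure g ->
  forall xp xm, states R xp -> states R xm -> f xp xm = g xp xm.
Proof.
move=> gamma1 fP gP fN gN xp xm Sp Sm.
have Deq := density_eq gamma1 fP gP fN gN.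
case: fP gP => _ fc fE fK _ [_ gc gE gK _].
have E : cmp3 (f xp xm) = cmp3 (g xp xm).
  have neq yp : states R yp -> cmp1 yp / cmp3 yp != cmp1 xm / cmp3 xm ->
      cmp3 (f yp xm) = cmp3 (g yp xm).
    move=> Syp b; have /= := EC_KEP_sub fE fK gE gK Syp Sm.
    rewrite Deq// subrr mulr0 add0r => /eqP.
    rewrite mulf_eq0 => /orP[|/eqP/subr0_eq//].
    by rewrite /cmp3/= -opprD oppr_eq0 subr_eq0 (negbTE b).
  have [b|] := eqVneq (cmp1 xp / cmp3 xp) (cmp1 xm / cmp3 xm); last exact: neq.
  apply: eq_flux_limit => //; first exact: cmp3_continuous.
  case: Sp => rp0 pp0 r r0 rne; apply: neq; first by split.
  rewrite -b; apply: contra_neq rne => /(mulIf _); apply.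
  by rewrite invr_eq0 gt_eqF.
move: (fK _ _ Sp Sm) (gK _ _ Sp Sm) (Deq _ _ Sp Sm) E.
move: (f xp xm) (g xp xm) => [[f1 f2] f3] [[g1 g2] g3].
by rewrite /cmp1 /cmp2 /cmp3/= => -> -> -> ->.
Qed.

(** * Properties of the explicit flux *)

Lemma EC_KEP_PEP_flux_consistent (R : realType) (gamma : R) :
  1 < gamma -> consistent gamma (EC_KEP_PEP_flux gamma).
Proof.
move=> gamma1 [[r v] p] [] + +; rewrite /cmp1 /cmp3/= => r0 p0.
rewrite /EC_KEP_PEP_flux /euler_flux /conserved /cmp1 /cmp2 /cmp3/=.
rewrite /log_mean !eqxx /mean /prod_mean.
by congr (_, _, _); field; rewrite ?gt_eqF//= subr_gt0.
Qed.

Lemma EC_KEP_PEP_flux_continuous (R : realType) (gamma : R) :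
  flux_continuous (EC_KEP_PEP_flux gamma).
Proof.
apply/flux_continuousP => z [rp0 pp0] [rm0 pm0].
have c1 : cmp1 x.1 @[x --> z] --> cmp1 z.1.
  by apply: continuous_cvg; [exact: cmp1_continuous|exact: cvg_fst].
have c2 : cmp2 x.1 @[x --> z] --> cmp2 z.1.
  by apply: continuous_cvg; [exact: cmp2_continuous|exact: cvg_fst].
have c3 : cmp3 x.1 @[x --> z] --> cmp3 z.1.
  by apply: continuous_cvg; [exact: cmp3_continuous|exact: cvg_fst].
have d1 : cmp1 x.2 @[x --> z] --> cmp1 z.2.
  by apply: continuous_cvg; [exact: cmp1_continuous|exact: cvg_snd].
have d2 : cmp2 x.2 @[x --> z] --> cmp2 z.2.
  by apply: continuous_cvg; [exact: cmp2_continuous|exact: cvg_snd].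
have d3 : cmp3 x.2 @[x --> z] --> cmp3 z.2.
  by apply: continuous_cvg; [exact: cmp3_continuous|exact: cvg_snd].
have cst (k : R) : k @[_ --> z] --> k by exact: cvg_cst.
have half (a b : _ -> R) (k l : R) : a x @[x --> z] --> k ->
    b x @[x --> z] --> l -> (a x + b x) / 2 @[x --> z] --> (k + l) / 2.
  by move=> ak bl; apply: cvgM => //; exact: cvgD.
have cL : log_mean (cmp1 x.1) (cmp1 x.2) @[x --> z] -->
    log_mean (cmp1 z.1) (cmp1 z.2) by exact: cvg_log_mean.
have cLb : log_mean (cmp1 x.1 / cmp3 x.1) (cmp1 x.2 / cmp3 x.2) @[x --> z] -->
    log_mean (cmp1 z.1 / cmp3 z.1) (cmp1 z.2 / cmp3 z.2).
  apply: cvg_log_mean; rewrite ?divr_gt0//.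
    by apply: cvgM => //; apply: cvgV => //; rewrite gt_eqF.
  by apply: cvgM => //; apply: cvgV => //; rewrite gt_eqF.
have Lb0 : log_mean (cmp1 z.1 / cmp3 z.1) (cmp1 z.2 / cmp3 z.2) != 0.
  by rewrite gt_eqF// log_mean_gt0// divr_gt0.
have cV := half _ _ _ _ c2 d2.
pose F := EC_KEP_PEP_flux gamma.
have density : cmp1 (F x.1 x.2) @[x --> z] --> cmp1 (F z.1 z.2).
  exact: cvgM cL cV.
have momentum : cmp2 (F x.1 x.2) @[x --> z] --> cmp2 (F z.1 z.2).
  exact: cvgD (cvgM cL (cvgM cV cV)) (half _ _ _ _ c3 d3).
have energy : cmp3 (F x.1 x.2) @[x --> z] --> cmp3 (F z.1 z.2).
  apply: cvgD; last exact: half _ _ _ _ (cvgM c3 d2) (cvgM d3 c2).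
  apply: cvgD; last first.
    exact: cvgM (cvgM (cvgM (cst (1 / (gamma - 1))) cL) (cvgV Lb0 cLb)) cV.
  exact: cvgM (cvgM (cvgM (cst (1 / 2)) cL) cV)
    (half _ _ _ _ (cvgM c2 d2) (cvgM d2 c2)).
exact: cvg_pair (cvg_pair density momentum) energy.
Qed.

(** With [[rho]] = {{rho}}_log [[log rho]] and
    [[beta]] / {{beta}}_log = [[log rho]] - [[log p]], all logarithms cancel. *)
Lemma EC_KEP_PEP_flux_EC (R : realType) (gamma : R) :
  1 < gamma -> EC gamma (EC_KEP_PEP_flux gamma).
Proof.
move=> gamma1 [[rp vp] pp] [[rm vm] pm] Sp Sm.
have [rp0 pp0] : 0 < rp /\ 0 < pp by [].
have [rm0 pm0] : 0 < rm /\ 0 < pm by [].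
rewrite /dot3 [X in X * _](_ : _ = cmp1 (entropy_vars gamma (rp, vp, pp))
    - cmp1 (entropy_vars gamma (rm, vm, pm)))// !cmp1_entropy_vars//.
rewrite /EC_KEP_PEP_flux /entropy_vars /flux_potential /cmp1 /cmp2 /cmp3/=.
have bp0 : 0 < rp / pp by exact: divr_gt0.
have bm0 : 0 < rm / pm by exact: divr_gt0.
have Lbe := log_mean_ln bp0 bm0; have Le := log_mean_ln rp0 rm0.
have Lb0 := log_mean_gt0 bp0 bm0.
rewrite !ln_div ?posrE// in Lbe.
move: (log_mean (rp / pp) _) Lbe Lb0 (log_mean rp rm) Le => Lb Lbe Lb0 L Le.
have {}Lbe : (- (rp / pp) + rm / pm) / Lb
    = - (ln rp - ln pp - (ln rm - ln pm)).
  have -> : - (rp / pp) + rm / pm = - (rp / pp - rm / pm).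
    by rewrite opprB addrC.
  by rewrite -Lbe mulNr mulrAC divff ?gt_eqF// mul1r.
rewrite /mean /prod_mean.
transitivity ((L * (ln rp - ln rm) - (rp - rm)) * ((vp + vm) / 2)
  + L * ((vp + vm) / 2) / (gamma - 1)
    * ((- (rp / pp) + rm / pm) / Lb + (ln rp - ln pp - (ln rm - ln pm)))).
  by field; rewrite !gt_eqF//= subr_gt0.
by rewrite Le Lbe subrr addNr mul0r mulr0 addr0.
Qed.

Lemma EC_KEP_PEP_flux_KEP (R : realType) (gamma : R) :
  KEP (EC_KEP_PEP_flux gamma).
Proof.
move=> xp xm _ _; rewrite /EC_KEP_PEP_flux /= [LHS]/cmp2 /= [in RHS]/cmp1 /=.
ring.
Qed.

(** At constant pressure {{rho}}_log / {{rho / p}}_log = p, by homogeneity. *)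
Lemma EC_KEP_PEP_flux_PEP (R : realType) (gamma : R) :
  1 < gamma -> PEP (EC_KEP_PEP_flux gamma).
Proof.
move=> gamma1.
exists (fun p v => p), (fun p v => p * v / (gamma - 1) + p * v).
move=> rp rm v p rp0 rm0 p0 F.
have L0 := log_mean_gt0 rp0 rm0.
rewrite /F /EC_KEP_PEP_flux /cmp1 /cmp2 /cmp3 /= log_meanZ ?invr_gt0//.
rewrite /mean /prod_mean; split; first by field.
by field; rewrite !gt_eqF//= subr_gt0.
Qed.

Theorem mainTheorem2 (R : realType) (gamma : R) (gamma_gt1 : 1 < gamma) :
  (forall f : R * R * R -> R * R * R -> R * R * R,
     continuous_EC_KEP_PEP gamma f ->
     ~ (forall p rhop rhom vp vm : R, 0 < p -> 0 < rhop -> 0 < rhom ->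
          density_perturbation f p rhop rhom vp vm = 0) ->
     density_flux_depends_on_pressure f) /\
  (continuous_EC_KEP_PEP gamma (EC_KEP_PEP_flux gamma) /\
   ~ density_flux_depends_on_pressure (EC_KEP_PEP_flux gamma)) /\
  (forall f : R * R * R -> R * R * R -> R * R * R,
     continuous_EC_KEP_PEP gamma f ->
     ~ density_flux_depends_on_pressure f ->
     forall xp xm : R * R * R, states R xp -> states R xm ->
       f xp xm = EC_KEP_PEP_flux gamma xp xm).
Proof.
have gP : continuous_EC_KEP_PEP gamma (EC_KEP_PEP_flux gamma).
  split; [exact: EC_KEP_PEP_flux_consistent|exact: EC_KEP_PEP_flux_continuous|
          exact: EC_KEP_PEP_flux_EC|exact: EC_KEP_PEP_flux_KEP|
          exact: EC_KEP_PEP_flux_PEP].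
have gN : ~ density_flux_depends_on_pressure (EC_KEP_PEP_flux gamma).
  by case=> rp [rm [vp [vm [pp [pm [qp [qm [_ _ _]]]]]]]].
split; [|split=> // f fP fN; exact: (flux_eq gamma_gt1 fP gP)].
move=> f fP chi; apply: contrapT => fN; apply: chi => p rp rm vp vm p0 rp0 rm0.
rewrite /density_perturbation (density_eq gamma_gt1 fP gP)//.
exact: subrr.
Qed.
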